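(* There exists an absolute constant $C>0$ such that for all real $0<\alpha,\beta<1$ and all integers $w\ge 2$, every $w$-uniform set system $\mathcal F$ of size $$|\mathcal F|\ \ge\ \left(\frac{C}{\alpha^2}\left(\log w\,\log\log w+\Big(\log\frac1\beta\Big)^2\right)\right)^w$$ contains an $(\alpha,\beta)$-robust sunflower.
   Context: A set system on a finite set $X$ is a collection of (distinct) subsets of $X$; it is $w$-uniform if every set in it has size exactly $w$. For $0<p<1$, $\mathcal U(X,p)$ denotes the distribution of a random subset $R\subset X$ in which each element of $X$ is included independently with probability $p$. A set system $\mathcal F$ on $X$ is $(\alpha,\beta)$-satisfying if $\Pr_{R\sim\mathcal U(X,\alpha)}[\exists S\in\mathcal F,\ S\subset R]>1-\beta$. For $T\subset X$, the link of $\mathcal F$ at $T$ is $\mathcal F_T=\{S\setminus T: S\in\mathcal F,\ T\subset S\}$. A (nonempty) set system $\mathcal G$ with common intersection $K=\bigcap_{S\in\mathcal G}S$ is an $(\alpha,\beta)$-robust sunflower if (i) $K\notin\mathcal G$, and (ii) $\mathcal G_K$ is $(\alpha,\beta)$-satisfying. $\mathcal F$ contains an $(\alpha,\beta)$-robust sunflower if some subcollection $\mathcal G\subset\mathcal F$ is one. Convention: $\log$ denotes the logarithm in base $1.9$, so that $\log\log w>0$ for every $w\ge2$. *)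

(* Defs.v *)
From HB Require Import structures.
From mathcomp Require Import all_boot all_order all_algebra.
From mathcomp Require Import reals exp.

Set Implicit Arguments.
Unset Strict Implicit.
Unset Printing Implicit Defensive.

Import Order.TTheory GRing.Theory Num.Theory.
Local Open Scope ring_scope.

Section SetSystems.
Variable X : finType.
Implicit Types F G : {set {set X}}.

Definition uniform (w : nat) F : Prop := forall S, S \in F -> #|S| = w.

Definition link F (T : {set X}) : {set {set X}} :=
  [set S :\: T | S in F & T \subset S].

(* This is [set: X] when G is empty. *)
Definition kernel G : {set X} := \bigcap_(S in G) S.

Variable R : realType.

(* The probability of the outcome A when each x : X is included independently
   with probability p. *)
Definition rsubset_mass (p : R) (A : {set X}) : R :=
  \prod_(x : X) (if x \in A then p else 1 - p).

Definition rsubset_prob (p : R) (E : pred {set X}) : R :=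
  \sum_(A : {set X} | E A) rsubset_mass p A.

Definition satisfying (alpha beta : R) F : Prop :=
  rsubset_prob alpha (fun A => [exists S in F, S \subset A]) > 1 - beta.

Definition robust_sunflower (alpha beta : R) G : Prop :=
  [/\ G != set0, kernel G \notin G & satisfying alpha beta (link G (kernel G))].

Definition contains_robust_sunflower (alpha beta : R) F : Prop :=
  exists2 G : {set {set X}}, G \subset F & robust_sunflower alpha beta G.

End SetSystems.

Definition log19 (R : realType) (x : R) : R := ln x / ln (19%:R / 10%:R).

(* Main.v *)
Require Import Defs.
From HB Require Import structures.
From mathcomp Require Import all_boot all_order all_algebra.
From mathcomp Require Import reals exp.
From mathcomp Require Import ring lra.

Set Implicit Arguments.
Unset Strict Implicit.
Unset Printing Implicit Defensive.

Import Order.TTheory GRing.Theory Num.Theory.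
Local Open Scope ring_scope.

(** Call a family [kappa]-spread if, for every set [A], at most a fraction
    [kappa ^- #|A|] of its members contain [A].  The theorem follows from a
    stronger bound, in which the base only has to exceed a constant times
    [(k + m ^+ 2) / alpha] with [2 ^ k >= w] and [2 ^ m >= 4 / beta].

    Reduction to spread families.  Choose [T] maximizing
    [kappa ^+ #|T| * #|F_T|].  Maximality says at once that the link [F_T] is
    [kappa]-spread and, since [kappa > 1], that [T] is the whole common
    intersection of the members of [F] containing [T]
    ([exists_spread_link]).  It remains to show that a [kappa]-spread family
    of sets of size at most [w] has a member inside a random set with
    probability more than [1 - beta].

    One round.  Expose a [p]-random set [W].  Replace each member [S] of the
    family by a fragment: the smallest [S' :\: W] over members [S'] contained
    in [W :|: S].  It is a subset of [S], so fragments inherit spreadness, and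
    whatever covers a fragment covers a member once [W] is added.  Fragments
    are rarely large.  Let [T] be the fragment of [S] and [Z := W :|: T].  By
    minimality, every member contained in [Z] contains [T]; so, if a member
    contained in [Z] is fixed as a function of [Z], then [T] is one of its
    subsets and [Z] and [T] determine [W].  Passing from [W] to [Z] costs at
    most a factor [p ^- #|T|] in probability, and spreadness leaves at most a
    fraction [kappa ^- #|T|] of the members as candidates for [S].  Hence the
    expected fraction of members with a fragment of size above [w'] is at most
    the sum of [(p * kappa) ^- #|T|] over the [T] of size above [w'] in one
    member ([expected_long_fragments]).

    Halving.  With [p := alpha / (2 * k)], each round halves the bound on the
    sizes, and the members with long fragments are discarded.  After [k]
    rounds sizes are at most [m]; the discarded fractions decrease
    geometrically and add up to at most [2^-1 ^+ m] in expectation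
    ([prob_misses_rounds]).

    Ending.  If at least half of the members survive, one round with density
    [alpha / (2 * m)] reveals a full member with probability at least one
    half, because the expected fraction of nonempty fragments is small.
    Repeating it independently [m] times gives failure probability
    [2^-1 ^+ m] ([prob_misses_small]).

    The total failure probability is at most [3 * 2^-1 ^+ m < beta].  As
    [k = O(log w)] and [m = O(1 + log (1 / beta))], and as [log (log w)] is
    bounded below by [log (log 2) > 0], the hypothesis on [#|F|] provides such
    a [kappa]. *)

(** * Random subsets with independent elements *)

Section RandomSubsets.
Variables (R : realType) (X : finType).
Implicit Types (p q : R) (A B T W Z : {set X}) (E : pred {set X}).

Lemma sum_sets_prod (h : X -> bool -> R) :
  \sum_(A : {set X}) \prod_x h x (x \in A) = \prod_x (h x true + h x false).
Proof.
rewrite bigA_distr; apply: eq_bigr => A _; apply: eq_bigr => x _.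
by case: (x \in A).
Qed.

Lemma rsubset_mass_ge0 p A : 0 <= p <= 1 -> 0 <= rsubset_mass p A.
Proof. by move=> p01; apply: prodr_ge0 => x _; case: ifP => _; lra. Qed.

Lemma sum_rsubset_mass p : \sum_(A : {set X}) rsubset_mass p A = 1.
Proof.
rewrite (sum_sets_prod (fun _ b => if b then p else 1 - p)).
by rewrite big1 // => x _; rewrite addrC subrK.
Qed.

Lemma rsubset_probE p E :
  rsubset_prob p E = \sum_(A : {set X}) rsubset_mass p A * (E A)%:R.
Proof.
rewrite /rsubset_prob big_mkcond; apply: eq_bigr => A _.
by case: (E A); rewrite ?mulr1 ?mulr0.
Qed.

Lemma rsubset_prob_ge0 p E : 0 <= p <= 1 -> 0 <= rsubset_prob p E.
Proof. by move=> p01; apply: sumr_ge0 => A _; apply: rsubset_mass_ge0. Qed.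

Lemma rsubset_prob_le1 p E : 0 <= p <= 1 -> rsubset_prob p E <= 1.
Proof.
move=> p01; rewrite rsubset_probE -[leRHS](sum_rsubset_mass p).
apply: ler_sum => A _; rewrite ler_piMr ?rsubset_mass_ge0 //.
by case: (E A); rewrite ?ler01 ?lexx.
Qed.

Lemma rsubset_probC p E :
  rsubset_prob p E = 1 - rsubset_prob p (fun A => ~~ E A).
Proof.
apply/eqP; rewrite eq_sym subr_eq -(sum_rsubset_mass p) /rsubset_prob.
by rewrite (bigID E).
Qed.

Lemma rsubset_prob_imp p (E E' : pred {set X}) : 0 <= p <= 1 ->
  (forall A, E A -> E' A) -> rsubset_prob p E <= rsubset_prob p E'.
Proof.
move=> p01 EE'; rewrite !rsubset_probE; apply: ler_sum => A _.
rewrite ler_wpM2l ?rsubset_mass_ge0 // ler_nat.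
by have := EE' A; case: (E A) (E' A) => [] [] // ->.
Qed.

(** The union of independent random sets of densities [p] and [q] is a random
    set of density [1 - (1 - p) * (1 - q)], so it may be exposed in two steps.
    The indicator of [A :|: B = Z] is a product over the points, so the double
    sum over [A] and [B] factors into one four-term sum per point. *)
Lemma rsubset_prob_union p q E :
  rsubset_prob (1 - (1 - p) * (1 - q)) E =
  \sum_(A : {set X}) rsubset_mass p A * rsubset_prob q (fun B => E (A :|: B)).
Proof.
pose hit A B Z (x : X) (a b : bool) : R :=
  (if a then p else 1 - p) * (if b then q else 1 - q)
  * (a || b == (x \in Z))%:R.
have hitE A B Z : rsubset_mass p A * rsubset_mass q B * (A :|: B == Z)%:R
    = \prod_x hit A B Z x (x \in A) (x \in B).
  rewrite /hit !big_split /=; congr (_ * _).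
  have [<-|neq] := eqVneq; first by rewrite big1 // => x _; rewrite inE eqxx.
  have [x neqx] : exists x, (x \in A :|: B) != (x \in Z).
    apply/existsP; apply: contraNT neq => /existsPn eqAB; apply/eqP/setP => x.
    by apply/eqP; rewrite -[_ == _]negbK eqAB.
  by rewrite (bigD1 x) //= -in_setU (negPf neqx) mul0r.
have massU Z : \sum_(A : {set X}) \sum_(B : {set X})
    rsubset_mass p A * rsubset_mass q B * (A :|: B == Z)%:R
    = rsubset_mass (1 - (1 - p) * (1 - q)) Z.
  under eq_bigr => A _ do under eq_bigr => B _ do rewrite hitE.
  under eq_bigr => A _ do
    rewrite (sum_sets_prod (fun x b => hit A set0 Z x (x \in A) b)).
  rewrite (sum_sets_prod (fun x a =>
    hit set0 set0 Z x a true + hit set0 set0 Z x a false)).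
  apply: eq_bigr => x _; rewrite /hit; case: (x \in Z) => /=; ring.
rewrite rsubset_probE; under eq_bigr => Z _ do rewrite -massU mulr_suml.
rewrite exchange_big /=; apply: eq_bigr => A _.
under eq_bigr => Z _ do rewrite mulr_suml.
rewrite exchange_big rsubset_probE mulr_sumr /=; apply: eq_bigr => B _.
rewrite (bigD1 (A :|: B)) //= eqxx mulr1 big1 ?addr0 ?mulrA // => Z.
by rewrite eq_sym => /negPf->; rewrite mulr0 mul0r.
Qed.

(** A coupling: a [q]-random set is a [p]-random set joined with an
    independent one of density [(q - p) / (1 - p)]. *)
Lemma rsubset_prob_decreasing p q E : 0 <= p -> p <= q -> q < 1 ->
  (forall A B, A \subset B -> E B -> E A) ->
  rsubset_prob q E <= rsubset_prob p E.
Proof.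
move=> p0 pq q1 Edec.
have -> : q = 1 - (1 - p) * (1 - (q - p) / (1 - p)) by field; lra.
have r01 : 0 <= (q - p) / (1 - p) <= 1.
  by rewrite divr_ge0 ?ler_pdivrMr /=; lra.
rewrite rsubset_prob_union rsubset_probE; apply: ler_sum => A _.
rewrite ler_wpM2l ?rsubset_mass_ge0 //; first lra.
case EA: (E A); first exact: rsubset_prob_le1.
rewrite /rsubset_prob big_pred0 // => B; apply/negP => EU.
by have := Edec _ _ (subsetUl A B) EU; rewrite EA.
Qed.

(** Bounds the mass of [W] through that of [W :|: T], at a price of [p^-1] per
    added point: moving a point from outside to inside replaces its factor
    [1 - p <= 1] by [p]. *)
Lemma rsubset_mass_add p W T : 0 <= p <= 1 -> [disjoint W & T] ->
  rsubset_mass p W * p ^+ #|T| <= rsubset_mass p (W :|: T).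
Proof.
move=> p01 disWT; rewrite -prodr_const big_mkcond -big_split /=.
apply: ler_prod => x _; rewrite inE.
case: ifP => [xW|_]; case: ifP => [xT|_] /=; rewrite ?mulr1.
- by have := disjointFr disWT xW; rewrite xT.
- by rewrite lexx andbT; lra.
- by rewrite mulr_ge0 ?ler_piMl; lra.
- by rewrite lexx andbT; lra.
Qed.

End RandomSubsets.

(** * Minimum fragments of a spread family *)

Section Families.
Variables (R : realType) (X I : finType).
Implicit Types (p q kappa N eps : R) (A B T W Z : {set X}).
Implicit Types (D : {set I}) (phi : I -> {set X}).

Definition misses D phi A := ~~ [exists i in D, phi i \subset A].

(** Members are indexed by [I] because distinct sets may acquire equal
    fragments, and [N] is a fixed reference count rather than [#|D|] so that
    the property survives the discarding of members. *)
Definition spread kappa N D phi : Prop :=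
  forall A, kappa ^+ #|A| * #|[set i in D | A \subset phi i]|%:R <= N.

Definition fragment_source D phi W i : I :=
  [arg min_(j < i | (j \in D) && (phi j \subset W :|: phi i)) #|phi j :\: W|].

Definition fragment D phi W i : {set X} :=
  phi (fragment_source D phi W i) :\: W.

Lemma fragmentP D phi W i : i \in D ->
  [/\ fragment_source D phi W i \in D,
      phi (fragment_source D phi W i) \subset W :|: fragment D phi W i,
      fragment D phi W i \subset phi i &
      forall j, j \in D -> phi j \subset W :|: phi i ->
        (#|fragment D phi W i| <= #|phi j :\: W|)%N].
Proof.
move=> iD; rewrite /fragment /fragment_source.
case: arg_minnP => [|j /andP[jD jsub] jmin]; first by rewrite iD subsetUr.
split=> // [||k kD ksub].
- by rewrite -subDset.
- by rewrite subDset.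
- by apply: jmin; rewrite kD.
Qed.

(** [phi j :\: W] is contained in the fragment and competes with it, so by
    minimality the two sets coincide. *)
Lemma fragment_sub_member D phi W i j : i \in D -> j \in D ->
  phi j \subset W :|: fragment D phi W i -> fragment D phi W i \subset phi j.
Proof.
move=> iD jD jsub; have [_ _ fsub fmin] := fragmentP phi W iD.
have dsub : phi j :\: W \subset fragment D phi W i by rewrite subDset.
have : phi j :\: W == fragment D phi W i.
  by rewrite eqEcard dsub fmin // (subset_trans jsub) // setUS.
by move=> /eqP <-; apply: subsetDl.
Qed.

(** It depends on [Z] alone: this is what makes the number of possible
    fragments small once [W :|: fragment D phi W i] is known. *)
Definition chosen_member D phi Z : {set X} :=
  if [pick j | (j \in D) && (phi j \subset Z)] is Some j then phi j else set0.

Lemma fragment_sub_chosen D phi W i : i \in D ->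
  fragment D phi W i \subset chosen_member D phi (W :|: fragment D phi W i).
Proof.
move=> iD; rewrite /chosen_member; case: pickP => [j /andP[jD jsub]|none].
  exact: fragment_sub_member.
have [sD ssub _ _] := fragmentP phi W iD.
by have := none (fragment_source D phi W i); rewrite sD ssub.
Qed.

Lemma spread_ge0 kappa N D phi : 0 <= kappa -> spread kappa N D phi -> 0 <= N.
Proof.
by move=> k0 /(_ set0); apply: le_trans; rewrite mulr_ge0 ?exprn_ge0.
Qed.

(** A double count.  The pair [(W, T)], with [T] a fragment for [W], is
    recovered from [Z := W :|: T] and from [T], which is a subset of
    [chosen_member D phi Z].  Its mass is at most that of [Z] times
    [p ^- #|T|], and at most [N * kappa ^- #|T|] indices have [T] as their
    fragment since all of these members contain [T].  Summing over [T] first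
    and then over [Z], of total mass [1], gives the bound. *)
Lemma expected_long_fragments p kappa N eps D phi w :
  0 < p <= 1 -> 0 < kappa -> 0 <= eps -> spread kappa N D phi ->
  (forall j, j \in D ->
     \sum_(T : {set X} | (w < #|T|)%N && (T \subset phi j))
        (p * kappa) ^- #|T| <= eps) ->
  \sum_W rsubset_mass p W * #|[set i in D | (w < #|fragment D phi W i|)%N]|%:R
    <= N * eps.
Proof.
move=> p01 k0 eps0 spr epsP; have N0 := spread_ge0 (ltW k0) spr.
have p01' : 0 <= p <= 1 by lra.
(* Satisfied by every fragment [T] for [W]. *)
pose good W T := [disjoint W & T] && (T \subset chosen_member D phi (W :|: T)).
have card_longE W : #|[set i in D | (w < #|fragment D phi W i|)%N]|
    = (\sum_(T : {set X} | (w < #|T|)%N)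
         #|[set i in D | fragment D phi W i == T]|)%N.
  rewrite -sum1_card (partition_big (fragment D phi W)
    (fun T => (w < #|T|)%N)) /= => [|i]; last by rewrite inE => /andP[].
  apply: eq_bigr => T wT; rewrite -sum1_card; apply: eq_bigl => i.
  by rewrite !inE; case: eqP => [->|]; rewrite ?wT ?andbT ?andbF.
have termP W T :
    rsubset_mass p W * #|[set i in D | fragment D phi W i == T]|%:R
    <= (good W T)%:R * (rsubset_mass p (W :|: T) * (N * (p * kappa) ^- #|T|)).
  have [->|[i]] := set_0Vmem [set i in D | fragment D phi W i == T].
    rewrite cards0 mulr0 !mulr_ge0 ?rsubset_mass_ge0 //.
    by rewrite invr_ge0 exprn_ge0 // mulr_ge0; lra.
  rewrite inE => /andP[iD /eqP fT].
  have dis : [disjoint W & T].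
    by rewrite -fT disjoint_sym disjoints_subset subDset setUCr.
  have -> : good W T by rewrite /good dis -fT fragment_sub_chosen.
  have massT : rsubset_mass p W <= rsubset_mass p (W :|: T) / p ^+ #|T|.
    by rewrite ler_pdivlMr ?exprn_gt0 ?rsubset_mass_add //; lra.
  have cardT :
      #|[set i in D | fragment D phi W i == T]|%:R <= N / kappa ^+ #|T|.
    rewrite ler_pdivlMr ?exprn_gt0 // mulrC; apply: le_trans (spr T).
    rewrite ler_wpM2l ?exprn_ge0 ?(ltW k0) // ler_nat subset_leq_card //.
    apply/subsetP => j; rewrite !inE => /andP[jD /eqP <-]; rewrite jD.
    by have [] := fragmentP phi W jD.
  apply: le_trans (ler_pM _ _ massT cardT) _; rewrite ?rsubset_mass_ge0 //.
  by rewrite mul1r exprMn invfM mulrACA -mulrA lexx.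
pose term T Z := rsubset_mass p Z * (N * (p * kappa) ^- #|T|).
have term0 T Z : 0 <= term T Z.
  rewrite /term !mulr_ge0 ?rsubset_mass_ge0 //.
  by rewrite invr_ge0 exprn_ge0 // mulr_ge0; lra.
(* For fixed [T], the sets [W] disjoint from [T] inject into the sets [Z] by
   [Z = W :|: T], [W = Z :\: T]. *)
apply: (@le_trans _ _ (\sum_(T : {set X} | (w < #|T|)%N)
    \sum_(Z : {set X} | T \subset chosen_member D phi Z) term T Z)).
  rewrite [leRHS](_ : _ = \sum_(T : {set X} | (w < #|T|)%N)
      \sum_(W : {set X})
        \sum_(Z | (T \subset chosen_member D phi Z) && (Z :\: T == W))
          term T Z); last first.
    by apply: eq_bigr => T _; rewrite (partition_big (fun Z => Z :\: T) xpredT).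
  rewrite [leRHS]exchange_big /=; apply: ler_sum => W _.
  rewrite card_longE natr_sum mulr_sumr; apply: ler_sum => T _.
  apply: le_trans (termP W T) _.
  case gWT: (good W T); last by rewrite mul0r sumr_ge0.
  rewrite mul1r; have /andP[dis sub] := gWT.
  rewrite (bigD1 (W :|: T)) /=; first by rewrite lerDl sumr_ge0.
  rewrite sub setDUl setDv setU0 /=; exact/eqP/setDidPl.
rewrite (exchange_big_dep xpredT) //= -[N * eps]mul1r.
rewrite -(sum_rsubset_mass X p) mulr_suml.
apply: ler_sum => Z _; rewrite -mulr_sumr ler_wpM2l ?rsubset_mass_ge0 //.
rewrite -mulr_sumr ler_wpM2l // /chosen_member.
case: pickP => [j /andP[jD _]|_]; first exact: epsP.
rewrite big_pred0 // => T; rewrite subset0.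
by case: eqVneq => [->|_]; rewrite ?cards0 ?andbF.
Qed.

(** If [A] contains the fragment of [i], then [W :|: A] contains the member
    from which this fragment was cut. *)
Lemma misses_fragment D D' phi W A : D' \subset D ->
  misses D phi (W :|: A) -> misses D' (fragment D phi W) A.
Proof.
move=> D'D; apply: contra => /existsP[i /andP[iD' sub]].
have [sD ssub _ _] := fragmentP phi W (subsetP D'D i iD').
apply/existsP; exists (fragment_source D phi W i).
by rewrite sD (subset_trans ssub) ?setUS.
Qed.

Lemma spread_fragment kappa N D D' phi W : 0 <= kappa -> D' \subset D ->
  spread kappa N D phi -> spread kappa N D' (fragment D phi W).
Proof.
move=> k0 D'D spr A; apply: le_trans (spr A).
rewrite ler_wpM2l ?exprn_ge0 // ler_nat subset_leq_card //.
apply/subsetP => i; rewrite !inE => /andP[/(subsetP D'D) iD sub].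
have [_ _ fsub _] := fragmentP phi W iD.
by rewrite iD (subset_trans sub).
Qed.

End Families.

(** * Sums over subsets and elementary inequalities *)

Section SubsetSums.
Variables (R : realFieldType) (X : finType).
Implicit Types (x : R) (S T : {set X}).

Lemma sum_subsets_expr x S :
  \sum_(T : {set X} | T \subset S) x ^+ #|T| = (1 + x) ^+ #|S|.
Proof.
rewrite -prodr_const [RHS]big_mkcond /=.
rewrite [RHS](eq_bigr (fun y => (if y \in S then x else 0) + 1)); last first.
  by move=> y _; case: ifP; rewrite ?add0r // addrC.
rewrite bigA_distr big_mkcond; apply: eq_bigr => T _.
case: ifPn => [/subsetP TS|/subsetPn[y yT yS]].
  rewrite -prodr_const big_mkcond; apply: eq_bigr => y _.
  by case: ifP => // /TS ->.
by rewrite (bigD1 y) //= yT (negPf yS) mul0r.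
Qed.

Lemma sum_long_subsets_le x w S : 0 <= x <= 1 ->
  \sum_(T : {set X} | (w < #|T|)%N && (T \subset S)) x ^+ #|T|
    <= 2 ^+ #|S| * x ^+ w.
Proof.
move=> x01; rewrite -natrX -card_powerset -sum1_card natr_sum mulr_suml.
rewrite big_mkcond [leRHS]big_mkcond; apply: ler_sum => T _.
rewrite powersetE mul1r.
case: (T \subset S); rewrite ?andbF ?andbT //=; case: ifP => [/ltnW wT|_] //.
  by apply: ler_wiXn2l => //; lra.
by rewrite exprn_ge0; lra.
Qed.

Lemma sum_nonempty_subsets x S :
  \sum_(T : {set X} | (0 < #|T|)%N && (T \subset S)) x ^+ #|T|
    = (1 + x) ^+ #|S| - 1.
Proof.
rewrite -sum_subsets_expr [in RHS](bigD1 set0) ?sub0set //=.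
rewrite cards0 expr0 addrAC subrr add0r.
by apply: eq_bigl => T; rewrite card_gt0 andbC.
Qed.

(** A linear upper bound for the power, complementing Bernoulli's inequality:
    it makes [(1 + x) ^+ n - 1] of order [n * x]. *)
Lemma expr1D_le x n : 0 <= x -> n%:R * x <= 2^-1 ->
  (1 + x) ^+ n <= 1 + 2 * n%:R * x.
Proof.
move=> x0; elim: n => [|n IH] nx; first by rewrite expr0; lra.
have nS : n.+1%:R = n%:R + 1 :> R by rewrite -natr1.
rewrite nS in nx *; have n0 : 0 <= n%:R :> R by [].
have IHn : (1 + x) ^+ n <= 1 + 2 * n%:R * x by apply: IH; nra.
rewrite exprS; have : n%:R * x * x <= 2^-1 * x by rewrite ler_wpM2r //; lra.
nra.
Qed.

Lemma bernoulli_ineq x n : 0 <= x <= 1 -> 1 - n%:R * x <= (1 - x) ^+ n.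
Proof.
move=> x01; elim: n => [|n IH]; first by rewrite expr0; lra.
rewrite -natr1 exprS; have n0 : 0 <= n%:R :> R by [].
have : (1 - x) * (1 - n%:R * x) <= (1 - x) * (1 - x) ^+ n.
  by rewrite ler_wpM2l //; lra.
nra.
Qed.

End SubsetSums.

(** * Covering a member of a spread family *)

Section Rounds.
Variables (R : realType) (X I : finType).
Implicit Types (p q kappa N eps eta : R) (A B T W Z : {set X}).
Implicit Types (D : {set I}) (phi : I -> {set X}).

Lemma misses_sub D phi A B : A \subset B -> misses D phi B -> misses D phi A.
Proof.
move=> AB; apply: contra => /existsP[i /andP[iD sub]].
by apply/existsP; exists i; rewrite iD (subset_trans sub).
Qed.

(** A union of [n] independent [p]-random sets can miss the family only if
    each of them does. *)
Lemma prob_misses_powers p n D phi : 0 <= p <= 1 ->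
  rsubset_prob (1 - (1 - p) ^+ n) (misses D phi)
    <= rsubset_prob p (misses D phi) ^+ n.
Proof.
move=> p01; elim: n => [|n IH].
  by rewrite !expr0 subrr rsubset_prob_le1 // lexx ler01.
have q01 : 0 <= 1 - (1 - p) ^+ n <= 1.
  by rewrite subr_ge0 exprn_ile1 ?gerBl ?exprn_ge0; lra.
rewrite [X in rsubset_prob X _](_ : _ =
    1 - (1 - p) * (1 - (1 - (1 - p) ^+ n))); last first.
  by rewrite exprS; ring.
rewrite rsubset_prob_union exprS [X in X * _]rsubset_probE mulr_suml.
apply: ler_sum => A _; rewrite -mulrA ler_wpM2l ?rsubset_mass_ge0 //.
case mA: (misses D phi A).
  rewrite mul1r (le_trans _ IH) // rsubset_prob_imp // => B.
  by apply: misses_sub; apply: subsetUr.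
rewrite mul0r /rsubset_prob big_pred0 // => B; apply: contraFF mA.
by apply: misses_sub; apply: subsetUl.
Qed.

Lemma card_spread_le kappa N D phi : spread kappa N D phi -> #|D|%:R <= N.
Proof.
move=> /(_ set0); rewrite cards0 expr0 mul1r; apply: le_trans.
rewrite ler_nat subset_leq_card //; apply/subsetP => i.
by rewrite inE sub0set andbT.
Qed.

(** When [W] misses the family, every fragment is nonempty; so the expected
    number of nonempty fragments is at least [#|D|] times the probability of
    missing. *)
Lemma prob_misses_one_round p kappa N D phi m :
  0 < p <= 1 -> 0 < kappa -> 0 < N -> 8 * m%:R <= p * kappa ->
  spread kappa N D phi -> (forall i, i \in D -> (#|phi i| <= m)%N) ->
  N <= 2 * #|D|%:R -> rsubset_prob p (misses D phi) <= 2^-1.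
Proof.
move=> p01 k0 N0 mk spr size ND.
have pk0 : 0 < p * kappa by rewrite mulr_gt0 //; lra.
have x0 : 0 <= (p * kappa)^-1 by rewrite invr_ge0 ltW.
have mx : m%:R * (p * kappa)^-1 <= 8^-1.
  by rewrite ler_pdivrMr //; lra.
have sums j : j \in D ->
    \sum_(T : {set X} | (0 < #|T|)%N && (T \subset phi j)) (p * kappa) ^- #|T|
      <= 4^-1.
  move=> jD; under eq_bigr => T _ do rewrite -exprVn.
  rewrite sum_nonempty_subsets.
  have : (1 + (p * kappa)^-1) ^+ #|phi j| <= (1 + (p * kappa)^-1) ^+ m.
    by rewrite ler_weXn2l ?size //; lra.
  have := @expr1D_le R (p * kappa)^-1 m x0; lra.
have q0 : 0 <= 4^-1 :> R by lra.
have := expected_long_fragments p01 k0 q0 spr sums.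
suff : rsubset_prob p (misses D phi) * #|D|%:R <= 
  \sum_W rsubset_mass p W * #|[set i in D | (0 < #|fragment D phi W i|)%N]|%:R.
  move=> H1 H2; rewrite -(ler_pM2r N0).
  have := @rsubset_prob_ge0 R X p (misses D phi); nra.
rewrite rsubset_probE mulr_suml; apply: ler_sum => W _.
rewrite -mulrA ler_wpM2l ?rsubset_mass_ge0 //; first lra.
case mW: (misses D phi W); last by rewrite mul0r.
rewrite mul1r ler_nat subset_leq_card //; apply/subsetP => i iD.
rewrite inE iD card_gt0 /=; apply: contraL mW => /eqP f0.
rewrite negbK; have [sD + _ _] := fragmentP phi W iD.
rewrite f0 setU0 => ssub.
by apply/existsP; exists (fragment_source D phi W i); rewrite sD.
Qed.

(** If [#|D|] is less than half of [N], the right-hand side exceeds [1].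
    Stating the bound for every [D], with an error linear in [#|D|], lets it
    be averaged over the random set of surviving members. *)
Lemma prob_misses_small p kappa N D phi m :
  0 < p <= 1 -> 0 < kappa -> 0 < N -> 8 * m%:R <= p * kappa ->
  spread kappa N D phi -> (forall i, i \in D -> (#|phi i| <= m)%N) ->
  rsubset_prob (1 - (1 - p) ^+ m) (misses D phi)
    <= 2^-1 ^+ m + 2 * (1 - #|D|%:R / N).
Proof.
move=> p01 k0 N0 mk spr size; have p01' : 0 <= p <= 1 by lra.
have DN : #|D|%:R / N <= 1 by rewrite ler_pdivrMr // mul1r (card_spread_le spr).
have h0 : 0 <= 2^-1 ^+ m :> R by apply: exprn_ge0; lra.
have [ND|ND] := lerP N (2 * #|D|%:R).
  have := prob_misses_one_round p01 k0 N0 mk spr size ND => le2.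
  apply: le_trans (prob_misses_powers _ _ _ p01') _.
  have : rsubset_prob p (misses D phi) ^+ m <= 2^-1 ^+ m.
    by rewrite lerXn2r ?nnegrE ?rsubset_prob_ge0 // invr_ge0.
  lra.
have : #|D|%:R / N < 2^-1 by rewrite ltr_pdivrMr //; lra.
suff : rsubset_prob (1 - (1 - p) ^+ m) (misses D phi) <= 1 by lra.
by rewrite rsubset_prob_le1 // subr_ge0 exprn_ile1 ?gerBl ?exprn_ge0; lra.
Qed.

(** Induction on the number of rounds.  One round passes from sizes at most
    [m * 2 ^ k.+1] to sizes at most [m * 2 ^ k] and discards an expected
    fraction of at most [2^-1 ^+ (m + k.+1)] of the reference count [N]; the
    linear dependence on [#|D|] turns it into a term of the error. *)
Lemma prob_misses_rounds p q kappa N eta m k D phi :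
  0 < p <= 1 -> 0 <= q <= 1 -> 0 < kappa -> 0 < N -> 16 <= p * kappa ->
  (0 < m)%N ->
  (forall D' phi', spread kappa N D' phi' ->
     (forall i, i \in D' -> (#|phi' i| <= m)%N) ->
     rsubset_prob q (misses D' phi') <= eta + 2 * (1 - #|D'|%:R / N)) ->
  spread kappa N D phi -> (forall i, i \in D -> (#|phi i| <= m * 2 ^ k)%N) ->
  rsubset_prob (1 - (1 - p) ^+ k * (1 - q)) (misses D phi)
    <= eta + 2 * (1 - #|D|%:R / N) + 2 * 2^-1 ^+ m * (1 - 2^-1 ^+ k).
Proof.
move=> p01 q01 k0 N0 pk m0 base; have p01' : 0 <= p <= 1 by lra.
elim: k D phi => [|k IH] D phi spr size.
  rewrite !expr0 mul1r subKr subrr mulr0 addr0; apply: base => // i iD.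
  by rewrite -[m]muln1 size.
set w := (m * 2 ^ k)%N; pose eps : R := 2^-1 ^+ (m + k.+1).
have eps0 : 0 <= eps by apply: exprn_ge0; lra.
have pk0 : 0 < p * kappa by lra.
have x0 : 0 <= (p * kappa)^-1 by rewrite invr_ge0 ltW.
have x16 : (p * kappa)^-1 <= 16^-1 by rewrite lef_pV2 ?posrE //; lra.
have long : \sum_W rsubset_mass p W *
    #|[set i in D | (w < #|fragment D phi W i|)%N]|%:R <= N * eps.
  apply: (expected_long_fragments p01 k0 eps0 spr) => j jD.
  under eq_bigr => T _ do rewrite -exprVn.
  apply: le_trans (sum_long_subsets_le _ _ _) _; first by lra.
  apply: (@le_trans _ _ (2 ^+ (w * 2) * 16^-1 ^+ w)).
    apply: ler_pM; rewrite ?exprn_ge0 //.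
      by rewrite ler_weXn2l ?ler1n // /w -mulnA -expnSr size.
    by rewrite lerXn2r ?nnegrE //; lra.
  (* [4 / 16 = 2^-1 ^+ 2], and [2 * w = m * 2 ^ k.+1] is at least [m + k.+1]. *)
  rewrite mulnC exprM -exprMn.
  rewrite (_ : 2 ^+ 2 * 16^-1 = 2^-1 ^+ 2 :> R); last by field.
  rewrite -exprM; apply: ler_wiXn2l; [lra|lra|].
  rewrite mul2n -addnn leq_add ?leq_pmulr ?expn_gt0 //.
  by rewrite (leq_trans (ltn_expl k (isT : (1 < 2)%N))) ?leq_pmull.
pose D' W := [set i in D | (#|fragment D phi W i| <= w)%N].
have D'D W : D' W \subset D by apply/subsetP => i; rewrite inE => /andP[].
have cardD W : #|D' W|%:R =
    #|D|%:R - #|[set i in D | (w < #|fragment D phi W i|)%N]|%:R :> R.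
  apply/eqP; rewrite eq_sym subr_eq -natrD eqr_nat -!sum1_card.
  rewrite (bigID (fun i => (#|fragment D phi W i| <= w)%N)) /=.
  apply/eqP; congr (_ + _)%N; apply: eq_bigl => i; rewrite inE //.
  by rewrite ltnNge.
have q'01 : 0 <= 1 - (1 - p) ^+ k * (1 - q) <= 1.
  have : 0 <= (1 - p) ^+ k <= 1 by rewrite exprn_ge0 ?exprn_ile1; lra.
  nra.
rewrite [X in rsubset_prob X _](_ : _ =
    1 - (1 - p) * (1 - (1 - (1 - p) ^+ k * (1 - q)))); last first.
  by rewrite exprS; ring.
rewrite rsubset_prob_union.
(* The bound for the remaining rounds if no member were discarded; each
   discarded member adds [2 / N] to it. *)
pose rest : R := eta + 2 * (1 - #|D|%:R / N) + 2 * 2^-1 ^+ m * (1 - 2^-1 ^+ k).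
apply: (@le_trans _ _ (\sum_W (rsubset_mass p W * rest +
    2 / N * (rsubset_mass p W *
      #|[set i in D | (w < #|fragment D phi W i|)%N]|%:R)))).
  apply: ler_sum => W _.
  rewrite [2 / N * _]mulrCA -mulrDr ler_wpM2l ?rsubset_mass_ge0 //.
  apply: le_trans (_ : rsubset_prob _ (misses (D' W) (fragment D phi W)) <= _).
    by apply: rsubset_prob_imp => // A; apply: misses_fragment.
  apply: le_trans (IH _ _ _ _) _.
  - exact: spread_fragment (ltW k0) _ _.
  - by move=> i; rewrite inE => /andP[].
  by rewrite cardD /rest le_eqVlt; apply/orP; left; apply/eqP; ring.
rewrite big_split -mulr_suml -mulr_sumr sum_rsubset_mass mul1r /=.
apply: (@le_trans _ _ (rest + 2 / N * (N * eps))).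
  by rewrite lerD2l ler_wpM2l // divr_ge0 // ltW.
rewrite mulrA divfK ?gt_eqF // /rest /eps exprD exprS.
set h := 2^-1 ^+ m; set g := 2^-1 ^+ k.
rewrite le_eqVlt; apply/orP; left; apply/eqP; field.
by rewrite gt_eqF.
Qed.

(** Half of the density [alpha] pays for the [k] halving rounds and the other
    half for the [m] final rounds. *)
Lemma prob_misses_spread alpha kappa D phi m k :
  0 < alpha < 1 -> (0 < m)%N -> (0 < k)%N -> D != set0 ->
  32 * (k%:R + m%:R ^+ 2) <= kappa * alpha ->
  spread kappa #|D|%:R D phi ->
  (forall i, i \in D -> (#|phi i| <= m * 2 ^ k)%N) ->
  rsubset_prob alpha (misses D phi) <= 3 * 2^-1 ^+ m.
Proof.
move=> a01 m0 k0 Dn0 kap spr size.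
have m1 : 1 <= m%:R :> R by rewrite ler1n.
have k1 : 1 <= k%:R :> R by rewrite ler1n.
have N0 : 0 < #|D|%:R :> R by rewrite ltr0n card_gt0.
have kappa0 : 0 < kappa.
  rewrite -(pmulr_lgt0 kappa (proj1 (andP a01))); apply: lt_le_trans kap.
  have := sqr_ge0 (m%:R : R); lra.
pose p := alpha / (2 * k%:R); pose p0 := alpha / (2 * m%:R).
have pE : k%:R * p = alpha / 2 by rewrite /p; field; lra.
have p0E : m%:R * p0 = alpha / 2 by rewrite /p0; field; lra.
have p_gt0 : 0 < p by rewrite divr_gt0 //; lra.
have p0_gt0 : 0 < p0 by rewrite divr_gt0 //; lra.
have p_le1 : p <= 1 by nra.
have p0_le1 : p0 <= 1 by nra.
have pk : 16 <= p * kappa.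
  rewrite /p mulrAC ler_pdivlMr; last lra.
  have : 0 <= m%:R ^+ 2 :> R by apply: exprn_ge0; lra.
  lra.
have p0k : 8 * m%:R <= p0 * kappa.
  rewrite /p0 mulrAC ler_pdivlMr; last lra.
  rewrite expr2 in kap; nra.
have bp := @bernoulli_ineq R p k; have bp0 := @bernoulli_ineq R p0 m.
rewrite pE in bp; rewrite p0E in bp0.
have {}bp : 1 - alpha / 2 <= (1 - p) ^+ k by apply: bp; lra.
have {}bp0 : 1 - alpha / 2 <= (1 - p0) ^+ m by apply: bp0; lra.
have ep : (1 - p) ^+ k <= 1 by rewrite exprn_ile1; lra.
have ep0 : (1 - p0) ^+ m <= 1 by rewrite exprn_ile1; lra.
set q := 1 - (1 - p0) ^+ m.
have q01 : 0 <= q <= 1 by rewrite /q; lra.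
have qE : 1 - q = (1 - p0) ^+ m by rewrite /q; ring.
apply: (@le_trans _ _
    (rsubset_prob (1 - (1 - p) ^+ k * (1 - q)) (misses D phi))).
  apply: rsubset_prob_decreasing; rewrite ?qE; [nra|nra|lra|].
  by move=> A B; apply: misses_sub.
have p01 : 0 < p <= 1 by rewrite p_gt0.
have p001 : 0 < p0 <= 1 by rewrite p0_gt0.
apply: le_trans (prob_misses_rounds (eta := 2^-1 ^+ m)
  p01 q01 kappa0 N0 pk m0 _ spr size) _.
  by move=> D' phi' spr' size'; apply: prob_misses_small p0k spr' size'.
rewrite divff ?gt_eqF // subrr mulr0 addr0.
have : 0 <= 2^-1 ^+ m :> R by apply: exprn_ge0; lra.
have : 0 <= 2^-1 ^+ k :> R by apply: exprn_ge0; lra.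
nra.
Qed.

End Rounds.

(** * From large families to spread links *)

Section SpreadLink.
Variables (R : realType) (X : finType).
Implicit Types (F : {set {set X}}) (T : {set X}).

Definition supersets F T : {set {set X}} := [set S in F | T \subset S].

(** [T] maximizes [kappa ^+ #|T| * #|supersets F T|].  Comparing with [set0]
    gives a value above [kappa ^+ w], the value of every member of [F], so
    [T] is not in [F].  Comparing with the kernel, which has the same
    supersets in [F], shows that the kernel is no larger than [T].  Comparing
    with [A :|: T] gives spreadness. *)
Lemma exists_spread_link (kappa : R) w F : 1 < kappa ->
  uniform w F -> kappa ^+ w < #|F|%:R ->
  exists T, [/\ supersets F T != set0, kernel (supersets F T) = T,
    T \notin F &
    spread kappa #|supersets F T|%:R (supersets F T) (fun S => S :\: T)].
Proof.
move=> kappa1 unif large; have kappa0 : 0 < kappa by lra.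
pose value T : R := kappa ^+ #|T| * #|supersets F T|%:R.
case: (@arg_maxP _ _ _ set0 xpredT value isT) => T _ maxT.
have {}maxT T' : value T' <= value T by apply: maxT.
have valueT : kappa ^+ w < value T.
  apply: lt_le_trans large _; apply: le_trans (maxT set0).
  rewrite /value cards0 mul1r ler_nat subset_leq_card //.
  by apply/subsetP => S SF; rewrite inE SF sub0set.
have cardT : 0 < #|supersets F T|%:R :> R.
  rewrite lt_neqAle ler0n andbT eq_sym; apply: contraTneq valueT => card0.
  by rewrite /value card0 mulr0 -leNgt exprn_ge0 // ltW.
exists T; split.
- by rewrite -card_gt0 -(ltr0n R).
- set K := kernel _; have TK : T \subset K.
    by apply/bigcapsP => S; rewrite inE => /andP[].
  have supK : supersets F K = supersets F T.
    apply/setP => S; rewrite !inE; case SF: (S \in F) => //=.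
    apply/idP/idP => [|TS]; first exact: subset_trans.
    by apply: bigcap_inf; rewrite inE SF.
  apply/eqP; rewrite eq_sym eqEcard TK -(ler_eXn2l kappa1).
  by rewrite -(ler_pM2r cardT) -{1}supK maxT.
- apply: contraTN valueT => TF; rewrite -leNgt /value unif //.
  rewrite (_ : supersets F T = [set T]) ?cards1 ?mulr1 //.
  apply/setP => S; rewrite !inE; apply/andP/eqP => [[SF TS]|->].
    by apply/eqP; rewrite eq_sym eqEcard TS !unif ?leqnn.
  by rewrite subxx.
move=> A; set D := [set _ in _ | _].
have [->|[S0 S0D]] := set_0Vmem D; first by rewrite cards0 mulr0.
have disAT : [disjoint A & T].
  by move: S0D; rewrite inE subsetD => /and3P[].
have DsubU : #|D|%:R <= #|supersets F (A :|: T)|%:R :> R.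
  rewrite ler_nat subset_leq_card //; apply/subsetP => S.
  rewrite !inE subsetD => /and3P[/andP[SF TS] AS _].
  by rewrite SF subUset AS TS.
rewrite -(ler_pM2l (exprn_gt0 #|T| kappa0)).
apply: le_trans (maxT (A :|: T)).
rewrite /value cardsU (disjoint_setI0 disAT) cards0 subn0 addnC exprD -mulrA.
by rewrite !ler_pM2l ?exprn_gt0.
Qed.

Lemma robust_sunflower_of_spread (alpha beta kappa : R) m k w F :
  0 < alpha < 1 -> (0 < m)%N -> (0 < k)%N -> (w <= 2 ^ k)%N ->
  4 * 2^-1 ^+ m <= beta -> 1 < kappa ->
  32 * (k%:R + m%:R ^+ 2) <= kappa * alpha ->
  uniform w F -> kappa ^+ w < #|F|%:R ->
  contains_robust_sunflower alpha beta F.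
Proof.
move=> a01 m0 k0 wk bm kappa1 kap unif large.
have [T [G0 kerT TF spr]] := exists_spread_link kappa1 unif large.
exists (supersets F T); first by apply/subsetP => S; rewrite inE => /andP[].
split=> //; rewrite kerT; first by rewrite inE (negPf TF).
rewrite /satisfying rsubset_probC.
have size S : S \in supersets F T -> (#|S :\: T| <= m * 2 ^ k)%N.
  rewrite inE => /andP[SF _]; apply: leq_trans (leq_pmull _ m0).
  by apply: leq_trans wk; rewrite -(unif S SF) subset_leq_card // subsetDl.
have := prob_misses_spread a01 m0 k0 G0 kap spr size.
set misses_prob := rsubset_prob _ _ => missle.
have h0 : 0 < 2^-1 ^+ m :> R by apply: exprn_gt0; lra.
suff : rsubset_prob alpha
    (fun A => ~~ [exists S in link (supersets F T) T, S \subset A])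
    <= misses_prob by lra.
apply: rsubset_prob_imp => [|A]; first lra.
apply: contra => /existsP[S /andP[SG sub]].
apply/existsP; exists (S :\: T); rewrite sub andbT.
by apply/imsetP; exists S => //; move: SG; rewrite !inE => /andP[-> ->].
Qed.

End SpreadLink.

(** * Numerical parameters *)

Section LogBounds.
Variable R : realType.
Implicit Types (beta x : R).

Lemma ln19_gt0 : 0 < ln (19%:R / 10%:R) :> R.
Proof. by apply: ln_gt0; lra. Qed.

Lemma ln19_lt_ln2 : ln (19%:R / 10%:R) < ln 2 :> R.
Proof. by rewrite ltr_ln ?posrE; lra. Qed.

Lemma ler_log19 (x y : R) : 0 < x -> x <= y -> log19 x <= log19 y.
Proof.
move=> x0 xy; rewrite /log19 ler_pM2r ?invr_gt0 ?ln19_gt0 //.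
by rewrite ler_ln ?posrE //; lra.
Qed.

Lemma log19_gt0 (x : R) : 1 < x -> 0 < log19 x.
Proof. by move=> x1; rewrite /log19 divr_gt0 ?ln19_gt0 ?ln_gt0. Qed.

Lemma log19_2_gt1 : 1 < log19 (2 : R).
Proof. by rewrite /log19 ltr_pdivlMr ?ln19_gt0 // mul1r ln19_lt_ln2. Qed.

(** The base [19 / 10] is less than [2], so [log19] dominates the binary
    logarithm. *)
Lemma nat_le_log19 (n : nat) (x : R) : 1 <= x -> 2 ^+ n <= x -> n%:R <= log19 x.
Proof.
move=> x1 nx; rewrite /log19 ler_pdivlMr ?ln19_gt0 //.
apply: (@le_trans _ _ (ln (2 ^+ n : R))); last first.
  by rewrite ler_ln ?posrE ?exprn_gt0 //; lra.
rewrite lnXn // -[ln 2 *+ _]mulr_natl ler_wpM2l ?ler0n //.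
exact: ltW ln19_lt_ln2.
Qed.

Lemma up_log2_le (w : nat) : (2 <= w)%N ->
  (up_log 2 w)%:R <= 1 + log19 (w%:R : R).
Proof.
move=> w2; have /andP[lt_w _] := up_log_bounds (isT : 1 < 2)%N w2.
have k0 : (0 < up_log 2 w)%N by rewrite up_log_gt0.
rewrite -(prednK k0) -natr1 addrC lerD2l nat_le_log19 ?ler1n //.
  exact: ltnW.
by rewrite -natrX ler_nat ltnW.
Qed.

Lemma exists_pow2_le beta : 0 < beta < 1 ->
  exists m : nat, [/\ (0 < m)%N, 4 * 2^-1 ^+ m <= beta &
    m%:R <= 3 + log19 (1 / beta)].
Proof.
move=> b01; have b1 : 1 < 1 / beta by rewrite ltr_pdivlMr; lra.
have /ex_minnP[n] : exists n, 1 / beta <= 2 ^+ n :> R.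
  by exists (Num.bound (1 / beta)); rewrite ltW // upper_nthrootP.
move=> nP nmin; exists n.+2; split=> //.
  rewrite !exprS exprVn (_ : 4 * _ = (2 ^+ n)^-1); last first.
    by field; rewrite expf_neq0 ?pnatr_eq0.
  rewrite ler_pdivrMr in nP; last lra.
  by rewrite -[_^-1]mul1r ler_pdivrMr ?exprn_gt0 // mulrC.
case: n nP nmin => [|n] nP nmin; first by move: nP; rewrite expr0 leNgt b1.
have : ~~ (1 / beta <= 2 ^+ n) by apply/negP => /nmin; rewrite ltnn.
rewrite -ltNge => /ltW /(nat_le_log19 (ltW b1)).
rewrite -!natr1; lra.
Qed.

End LogBounds.

(** * The bound for robust sunflowers *)

Theorem theorem1p9 (R : realType) :
  exists C : R, 0 < C /\
    forall (alpha beta : R), 0 < alpha < 1 -> 0 < beta < 1 ->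
    forall w : nat, (2 <= w)%N ->
    forall (X : finType) (F : {set {set X}}), uniform w F ->
      (C / alpha ^+ 2 *
        (log19 w%:R * log19 (log19 w%:R) + log19 (1 / beta) ^+ 2)) ^+ w
        <= #|F|%:R ->
      contains_robust_sunflower alpha beta F.
Proof.
pose b : R := log19 (log19 2).
have b0 : 0 < b := log19_gt0 (log19_2_gt1 R).
have ib0 : 0 < b^-1 by rewrite invr_gt0.
(* [k + m ^+ 2 <= (20 / b + 2) * Q], the spread lemma needs [32] times that,
   and a factor [2] makes the bound on [#|F|] strict. *)
exists (64 * (20 / b + 2)); split; first lra.
move=> alpha beta a01 b01 w w2 X F unif.
set l := log19 w%:R; set P := l * _; set lam := log19 (1 / beta) => large.
have l2 : log19 2 <= l by rewrite ler_log19 // ler_nat.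
have l1 : 1 < l := lt_le_trans (log19_2_gt1 R) l2.
have bP : l * b <= P.
  have := log19_2_gt1 R => l2_gt1.
  rewrite ler_pM2l; last lra.
  by apply: ler_log19 => //; lra.
have lP : l <= P / b by rewrite ler_pdivlMr.
have P0 : 0 < P by rewrite (lt_le_trans _ bP) // mulr_gt0 //; lra.
have lam0 : 0 <= lam ^+ 2 := sqr_ge0 lam.
have kl : (up_log 2 w)%:R <= 1 + l := up_log2_le R w2.
have [m [m0 mb ml]] := exists_pow2_le b01.
rewrite -/lam in ml; set k := up_log 2 w in kl.
have k0 : (0 < k)%N by rewrite up_log_gt0.
have m1 : 1 <= m%:R :> R by rewrite ler1n.
have mm : m%:R ^+ 2 <= 18 + 2 * lam ^+ 2.
  have : m%:R ^+ 2 <= (3 + lam) ^+ 2 by rewrite lerXn2r ?nnegrE //; lra.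
  have := sqr_ge0 (3 - lam); rewrite !expr2; lra.
have kmP : k%:R + m%:R ^+ 2 <= (20 / b + 2) * (P + lam ^+ 2).
  have : 0 <= lam ^+ 2 / b by rewrite divr_ge0 // ltW.
  have -> : (20 / b + 2) * (P + lam ^+ 2) =
    20 * (P / b) + 2 * P + 20 * (lam ^+ 2 / b) + 2 * lam ^+ 2 by ring.
  lra.
set Q := P + lam ^+ 2 in kmP large; set c := 20 / b + 2 in kmP large.
have Q0 : 0 < Q by rewrite /Q; lra.
have c0 : 0 < c by rewrite /c; lra.
clearbody Q c.
pose kappa := 32 * c * Q / alpha ^+ 2.
have a0 : 0 < alpha by lra.
have kE : kappa * alpha * alpha = 32 * c * Q by rewrite /kappa; field; lra.
have cQ0 : 0 < 32 * c * Q by rewrite !mulr_gt0.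
have kappa0 : 0 < kappa by rewrite divr_gt0 ?exprn_gt0.
have kappaE : 64 * c / alpha ^+ 2 * Q = 2 * kappa by rewrite /kappa; ring.
clearbody kappa.
have ka : 32 * c * Q <= kappa * alpha.
  rewrite -kE; apply: ler_piMr; first exact: ltW (mulr_gt0 kappa0 a0).
  by have /andP[_ /ltW] := a01.
have kap : 32 * (k%:R + m%:R ^+ 2) <= kappa * alpha.
  by apply: le_trans ka; lra.
have kappa1 : 1 < kappa.
  have : kappa * alpha <= kappa.
    by apply: ler_piMr; [exact: ltW | have /andP[_ /ltW] := a01].
  have : 1 <= m%:R ^+ 2 :> R by rewrite exprn_ege1.
  have := ler0n R k; lra.
have wk : (w <= 2 ^ k)%N.
  by have /andP[] := up_log_bounds (isT : 1 < 2)%N w2.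
apply: robust_sunflower_of_spread a01 m0 k0 wk mb kappa1 kap unif _.
apply: lt_le_trans large.
have lt_kappa : kappa < 2 * kappa by rewrite mulr_natl mulr2n ltrDl.
have ge0_kappa : kappa \is Num.nneg by rewrite nnegrE ltW.
have w0 : (0 < w)%N := ltnW w2.
by rewrite kappaE ltr_pXn2r // nnegrE mulr_ge0 // ltW.
Qed.
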